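(* Let $r,s$ be real numbers with $s=r<0$, let $G$ be a finite group and let $n$ be a positive divisor of $|G|$. Then $T_{G,n}(r,s)\ge 0$, with equality if and only if $G$ contains exactly one subgroup of order $n$ and this subgroup is nilpotent. In particular (taking $n=|G|$), for every real $r<0$ and every finite group $G$ of order $N$, $\sum_{x\in G}\left(\frac{o(x)}{\varphi(o(x))}\right)^r \ge \sum_{x\in C_N}\left(\frac{o(x)}{\varphi(o(x))}\right)^r$, with equality if and only if $G$ is nilpotent.
   Context: $o(x)$ is the order of $x$, $\varphi$ is Euler's totient function, and $C_N$ is the cyclic group of order $N$. For a finite group $G$, a positive divisor $n$ of $|G|$ and reals $r,s$, define $R_{G,n}(r,s) := \sum_{x\in G,\ o(x)\mid n} \frac{o(x)^s}{\varphi(o(x))^r}$ and $T_{G,n}(r,s) := R_{G,n}(r,s) - R_{C_{|G|},n}(r,s)$. *)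

(* Defs.v *)
From Stdlib Require Import Reals.
From mathcomp Require Import all_boot all_fingroup all_algebra all_solvable.
Set Implicit Arguments. Unset Strict Implicit. Unset Printing Implicit Defensive.

Definition Rsum (gT : finGroupType) (G : {set gT}) (n : nat) (r s : R) : R :=
  \big[Rplus/R0]_(x in G | #[x]%g %| n)
     (Rdiv (Rpower (INR #[x]%g) s) (Rpower (INR (totient #[x]%g)) r)).

(* The cyclic group C_N, realised as the additive group Z/NZ = 'I_N
   (for N >= 1, 'I_(N.-1).+1 = 'I_N with its additive finGroupType structure). *)
Definition cyc (N : nat) : {set 'I_(N.-1).+1} := [set: 'I_(N.-1).+1].

Definition Tdiff (gT : finGroupType) (G : {set gT}) (n : nat) (r s : R) : R :=
  Rminus (Rsum G n r s) (Rsum (cyc #|G|) n r s).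

Definition Ssum (gT : finGroupType) (G : {set gT}) (r : R) : R :=
  \big[Rplus/R0]_(x in G) Rpower (Rdiv (INR #[x]%g) (INR (totient #[x]%g))) r.

(* Main.v *)
(** For s = r the summand depends only on the set of primes dividing o(x): it is
    the product over p | o(x) of c_p = (1 - 1/p)^(-r), where 0 < c_p < 1 since
    r < 0.  Writing the missing factors as 1 = c_p + (1 - c_p) and expanding,
    the sum over x becomes a combination, with positive coefficients indexed by
    sets pi of primes, of the numbers of solutions of x^(n_pi) = 1, where n_pi
    is the pi-part of n.  By Frobenius' theorem each of these numbers is at
    least n_pi, its value for the cyclic group; equality for every pi means that
    G has a single subgroup of order n and that this subgroup is nilpotent. *)

Require Import Defs.
From mathcomp Require Import Rstruct.
From Stdlib Require Import Reals.
From mathcomp Require Import all_boot all_order all_fingroup all_algebra all_solvable.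
Set Implicit Arguments. Unset Strict Implicit. Unset Printing Implicit Defensive.

(** * Unique nilpotent subgroups and the number of solutions of [x ^ n_pi = 1] *)

Section UniqueSubgroup.

Import GroupScope.

(** Descend from [P]: a proper subgroup [K] lies in a maximal subgroup of [P], which has index [p],
    so its order is still a multiple of [p ^ b] as long as [#|P|] is not [p ^ b] itself. *)
Lemma p_subgroup_between (gT : finGroupType) (p b : nat) (P K : {group gT}) :
    p.-group P -> K \subset P -> #|K| %| p ^ b -> p ^ b %| #|P| ->
  exists M : {group gT}, [/\ K \subset M, M \subset P & #|M| = (p ^ b)%N].
Proof.
have [m] := ubnP #|P|; elim: m P => // m IHm P /ltnSE-lePm pP sKP dvKb dvbP.
have [eqPb | neqPb] := eqVneq #|P| (p ^ b)%N; first by exists P.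
have [eqKP | [M maxM sKM]] := maximal_exists sKP.
  by case/eqP: neqPb; apply/eqP; rewrite eqn_dvd dvbP -eqKP dvKb.
have sMP := maxgroupp maxM; have iM := p_maximal_index pP maxM.
have oP : #|P| = (#|M| * p)%N by rewrite -(Lagrange (proper_sub sMP)) iM.
have [||M1 [sKM1 sM1M oM1]] := IHm M _ (pgroupS (proper_sub sMP) pP) sKM dvKb.
- exact: leq_trans (proper_card sMP) lePm.
- have ntP : P :!=: 1.
    by apply: contraTneq sMP => ->; rewrite properE sub1G andbF.
  have [pr_p _ _] := pgroup_pdiv pP ntP.
  have [c Dc] := p_natP pP; have [d Dd] := p_natP (pgroupS (proper_sub sMP) pP).
  move: dvbP neqPb oP; rewrite Dc Dd -expnSr => dvbP neqPb /eqP.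
  rewrite eqn_exp2l ?prime_gt1 // => /eqP Ec.
  rewrite dvdn_Pexp2l ?prime_gt1 // in dvbP.
  rewrite dvdn_Pexp2l ?prime_gt1 // -ltnS -Ec.
  by rewrite ltn_neqAle dvbP andbT; apply: contraNneq neqPb => ->.
by exists M1; split; rewrite // (subset_trans sM1M) ?proper_sub.
Qed.

Section OneSubgroup.

Variables (gT : finGroupType) (n : nat) (G H : {group gT}).
Hypotheses (sHG : H \subset G) (oH : #|H| = n) (nilH : nilpotent H).
Hypothesis uniqH :
  forall K : {group gT}, K \subset G -> #|K| = n -> K :=: H.

Lemma unique_order_normal : H <| G.
Proof.
apply/andP; split=> //; apply/subsetP=> x Gx; rewrite inE.
by have /= -> := @uniqH (H :^ x)%G; rewrite ?conj_subG ?cardJg.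
Qed.

(* A p-subgroup Q of order n`_p normalises the p'-core of H, and their product
   is a subgroup of order n, hence is H. *)
Lemma mem_unique_order_p_elt (p : nat) (x : gT) :
  x \in G -> p.-elt x -> #[x] %| n -> x \in H.
Proof.
move=> Gx p_x dv_x_n; have n_gt0 : 0 < n by rewrite -oH cardG_gt0.
have sxG : <[x]> \subset G by rewrite cycle_subG.
have [P sylP sxP] := Sylow_superset sxG p_x.
have [sPG pP _] := and3P sylP.
have Dp : (n`_p)%N = (p ^ logn p n)%N := p_part p n.
have [||Q [sxQ sQP oQ]] := @p_subgroup_between _ p (logn p n) P <[x]> pP sxP.
- by rewrite -Dp -[#|_|]/#[x] -(part_pnat_id p_x) partn_dvd.
- by rewrite -Dp (card_Hall sylP) partn_dvd // -oH cardSg.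
rewrite -Dp in oQ.
have hallL := nilpotent_pcore_Hall p^' nilH.
have nLQ : Q \subset 'N('O_p^'(H)).
  apply: subset_trans (subset_trans sQP sPG) _.
  exact: normal_norm (gFnormal_trans _ unique_order_normal).
have oQL : #|'O_p^'(H) <*> Q| = n.
  rewrite norm_joinEr // coprime_cardMg (card_Hall hallL) oH oQ.
    by rewrite mulnC partnC.
  by rewrite coprime_sym coprime_partC.
rewrite -(@uniqH ('O_p^'(H) <*> Q)%G) //.
  by apply: (subsetP (joing_subr _ _)); rewrite -cycle_subG.
rewrite join_subG (subset_trans sQP sPG) andbT.
exact: subset_trans (pcore_sub _ _) sHG.
Qed.

Lemma mem_unique_order (x : gT) : x \in G -> #[x] %| n -> x \in H.
Proof.
move=> Gx dv_x_n; rewrite -(prod_constt x); apply: group_prod => p _.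
apply: (@mem_unique_order_p_elt p).
- by rewrite groupX.
- exact: p_elt_constt.
- by apply: dvdn_trans dv_x_n; rewrite order_constt dvdn_part.
Qed.

(** All solutions lie in [H], where they form the [pi]-core; as [H] is nilpotent, this core is a
    Hall subgroup. *)
Lemma card_Ldiv_unique_order (pi : nat_pred) : #|'Ldiv_(n`_pi)(G)| = (n`_pi)%N.
Proof.
have hallO := nilpotent_pcore_Hall pi nilH.
rewrite -{2}oH -(card_Hall hallO); apply: eq_card => x.
apply/LdivP/idP=> [[Gx] | Ox].
  move/eqP; rewrite -order_dvdn => dv_x.
  have Hx : x \in H by rewrite mem_unique_order ?(dvdn_trans dv_x) ?dvdn_part.
  rewrite (mem_normal_Hall hallO (pcore_normal _ _) Hx).
  exact: pnat_dvd dv_x (part_pnat _ _).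
have Hx := subsetP (pcore_sub _ _) x Ox; split; first exact: (subsetP sHG).
by apply/eqP; rewrite -order_dvdn -{1}oH -(card_Hall hallO) order_dvdG.
Qed.

End OneSubgroup.

Lemma Ldiv_eq_subgroup (gT : finGroupType) (m : nat) (G K : {group gT}) :
  K \subset G -> #|K| = m -> #|'Ldiv_m(G)| = m -> K :=: 'Ldiv_m(G).
Proof.
move=> sKG oK oL; apply/eqP; rewrite eqEcard oL oK leqnn andbT.
apply/subsetP=> x Kx; apply/LdivP; split; first exact: (subsetP sKG).
by apply/eqP; rewrite -order_dvdn -oK order_dvdG.
Qed.

(** A subgroup of this order inside a Sylow subgroup fills the whole solution set, which is stable
    under conjugation. *)
Lemma normal_p_subgroup_of_Ldiv (gT : finGroupType) (n p : nat) (G : {group gT}) :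
    0 < n -> n %| #|G| -> #|'Ldiv_(n`_p)(G)| = (n`_p)%N ->
  exists P : {group gT}, P <| G /\ #|P| = (n`_p)%N.
Proof.
move=> n_gt0 dv_n_G oL.
have [S sylS] := Sylow_exists p G; have [sSG pS _] := and3P sylS.
have [||P [_ sPS oP]] := @p_subgroup_between _ p (logn p n) S 1 pS (sub1G S).
- by rewrite cards1 dvd1n.
- by rewrite -p_part (card_Hall sylS) partn_dvd.
rewrite -p_part in oP; have sPG := subset_trans sPS sSG.
exists P; split=> //; apply/andP; split=> //; apply/subsetP=> x Gx.
by rewrite inE (Ldiv_eq_subgroup sPG oP oL) -LdivJ conjGid.
Qed.

Lemma unique_nilpotent_subgroupP (gT : finGroupType) (n : nat) (G : {group gT}) :
    0 < n -> n %| #|G| ->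
  (forall pi : nat_pred, #|'Ldiv_(n`_pi)(G)| = (n`_pi)%N) <->
  exists H : {group gT},
    [/\ H \subset G, #|H| = n, nilpotent H &
        forall K : {group gT}, K \subset G -> #|K| = n -> K :=: H].
Proof.
move=> n_gt0 dv_n_G; split=> [oL | [H [sHG oH nilH uniqH]] pi]; last first.
  exact: card_Ldiv_unique_order uniqH _.
(* The subgroup is assembled one prime at a time from normal [p]-subgroups. Staying inside the
   Fitting subgroup makes the result nilpotent. *)
have existsH (s : seq nat) : uniq s ->
  exists H : {group gT}, H \subset 'F(G) /\ #|H| = (n`_[pred q in s])%N.
  elim: s => [|p s IHs] /=.
    exists 1%G; rewrite sub1G cards1; split=> //.
    by rewrite part_p'nat //; apply/pnatP.
  case/andP=> s'p /IHs[K [sKF oK]].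
  have [P [nPG oP]] := normal_p_subgroup_of_Ldiv n_gt0 dv_n_G (oL p).
  have pP : p.-group P by rewrite /pgroup oP part_pnat.
  have sPF : P \subset 'F(G) by rewrite Fitting_max ?(pgroup_nil pP).
  exists (P <*> K)%G; rewrite join_subG sPF sKF; split=> //=.
  (* Since [p] is not in [s], [P] and [K] have as orders the [p]-part and the [p']-part of the
     target order, so these are coprime and multiply to it. *)
  have Ep : (n`_p)%N = ((n`_[pred q in p :: s])`_p)%N.
    rewrite -partnI; apply: eq_partn => q.
    by rewrite !inE /=; case: (q == p); rewrite ?andbF.
  have Es : (n`_[pred q in s])%N = ((n`_[pred q in p :: s])`_p^')%N.
    rewrite -partnI; apply: eq_partn => q; rewrite !inE /=.
    by case: eqP => [->|_]; rewrite ?(negbTE s'p) ?andbF ?andbT.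
  rewrite norm_joinEr ?coprime_cardMg ?oP ?oK ?Ep ?Es ?coprime_partC ?partnC //.
  exact: subset_trans (subset_trans sKF (Fitting_sub G)) (normal_norm nPG).
have [H [sHF oH]] := existsH (primes n) (primes_uniq n).
have{} oH : #|H| = n by rewrite oH partn_pi.
have sHG := subset_trans sHF (Fitting_sub G).
(* Any subgroup of order [n] must now equal the solution set of [x ^ n = 1], whence uniqueness. *)
have oLn : #|'Ldiv_n(G)| = n by have := oL \pi(n); rewrite partn_pi.
exists H; split=> // [|K sKG oK]; first exact: nilpotentS sHF (Fitting_nil G).
by rewrite (Ldiv_eq_subgroup sKG oK oLn) (Ldiv_eq_subgroup sHG oH oLn).
Qed.

(** By Frobenius the number of solutions is a multiple of [e], and it is positive because 1 is a
    solution. *)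
Lemma leq_card_Ldiv (gT : finGroupType) (G : {group gT}) (e : nat) :
  e %| #|G| -> e <= #|'Ldiv_e(G)|.
Proof.
move=> dv_e; apply: dvdn_leq (Frobenius_Ldiv dv_e).
by apply/card_gt0P; exists 1; apply/LdivP; rewrite group1 expg1n.
Qed.

Lemma card_Ldiv_cyclic (gT : finGroupType) (G : {group gT}) (e : nat) :
  cyclic G -> e %| #|G| -> #|'Ldiv_e(G)| = e.
Proof.
move=> cycG dv_e; have [a defG] := cyclicP cycG.
rewrite defG -orderE in dv_e; have [k oa] := dvdnP dv_e.
have k_gt0 : 0 < k by have := order_gt0 a; rewrite oa; case: (k).
have ob : #[a ^+ k] = e by rewrite orderXdiv oa ?dvdn_mulr ?mulKn.
have sbG : <[a ^+ k]> \subset G by rewrite defG cycleX.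
rewrite -[RHS]ob orderE; apply: eq_card => x; apply/LdivP/idP=> [[Gx] | bx].
  move/eqP; rewrite -order_dvdn => dv_x.
  rewrite -cycle_subG -(cardSg_cyclic cycG) //; last by rewrite cycle_subG.
  by rewrite -[X in X %| _]/#[x] -[X in _ %| X]/#[a ^+ k] ob.
split; first exact: (subsetP sbG).
by move/order_dvdG: bx; rewrite -orderE ob order_dvdn => /eqP.
Qed.

End UniqueSubgroup.

(** * Expansion of the summand with positive coefficients *)

Section Weights.

Import Order.TTheory GRing.Theory Num.Theory.
Local Open Scope ring_scope.

Lemma Rpower_gt0 (x y : R) : 0 < Rpower x y.
Proof. exact/RltP/exp_pos. Qed.

Lemma Rpower_inv (x y : R) : 0 < x -> Rpower x^-1 y = Rpower x (- y).
Proof.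
by move/RltP=> x_gt0; rewrite /Rpower -RinvE ln_Rinv // !RealsE mulrN mulNr.
Qed.

Lemma Rpower_div (x y z : R) :
  0 < x -> 0 < y -> Rdiv (Rpower x z) (Rpower y z) = Rpower (Rdiv x y) z.
Proof.
move=> x_gt0 y_gt0; rewrite /Rdiv -Rpower_mult_distr; try exact/RltP.
  by rewrite RinvE Rpower_inv // Rpower_Ropp.
by apply/RltP; rewrite RinvE invr_gt0.
Qed.

Lemma Rpower_prod (I : eqType) (s : seq I) (F : I -> R) (y : R) :
    (forall i, i \in s -> 0 < F i) ->
  Rpower (\prod_(i <- s) F i) y = \prod_(i <- s) Rpower (F i) y.
Proof.
elim: s => [_ | i s IHs F_gt0]; first by rewrite !big_nil /Rpower ln_1 Rmult_0_r exp_0.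
have Fs_gt0 j : j \in s -> 0 < F j by move=> sj; rewrite F_gt0 // inE sj orbT.
rewrite !big_cons -IHs // -!RmultE Rpower_mult_distr //; apply/RltP.
  by rewrite F_gt0 ?mem_head.
by rewrite big_seq prodr_gt0.
Qed.

Lemma prime_ratio_bounds (p : nat) : prime p -> 0 < 1 - (p%:R : R)^-1 < 1.
Proof.
move=> pr_p; have p_gt0 : 0 < p%:R :> R by rewrite ltr0n prime_gt0.
by rewrite subr_gt0 invf_lt1 ?ltr1n ?prime_gt1 // gtrBl invr_gt0.
Qed.

(** A prime power [p ^ e] with [e > 0] contributes [p / (p - 1)], whatever [e] is. *)
Lemma div_totient (m : nat) : (0 < m)%N ->
  m%:R / (totient m)%:R = \prod_(p <- primes m) (1 - p%:R^-1)^-1 :> R.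
Proof.
move=> m_gt0; rewrite totientE // {1}(prod_prime_decomp m_gt0) prime_decompE.
rewrite big_map /= !natr_prod -prodf_div; apply: eq_big_seq => p.
rewrite mem_primes => /and3P[pr_p _ dv_p_m].
have p_neq0 : p%:R != 0 :> R by rewrite pnatr_eq0 -lt0n prime_gt0.
have e_gt0 : (0 < logn p m)%N by rewrite logn_gt0 mem_primes pr_p m_gt0.
rewrite -[in (p ^ logn p m)%N](prednK e_gt0) expnS !natrM.
rewrite -mulf_div divff ?mulr1; last by rewrite pnatr_eq0 -lt0n expn_gt0 prime_gt0.
rewrite -invf_div; congr _^-1.
by rewrite -subn1 natrB ?prime_gt0 // mulrBl divff // mul1r.
Qed.

(* The value at the composite numbers is irrelevant, as long as it is in ]0, 1[. *)
Definition local_weight (r : R) (p : nat) : R :=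
  if prime p then Rpower (1 - p%:R^-1) (- r) else 2^-1.

Lemma local_weight_bounds (r : R) (p : nat) : r < 0 -> 0 < local_weight r p < 1.
Proof.
rewrite /local_weight => r_lt0; case: ifP => [pr_p | _]; last first.
  by rewrite invr_gt0 ltr0n invf_lt1 ?ltr1n ?ltr0n.
have /andP[/RltP x_gt0 /RltP x_lt1] := prime_ratio_bounds pr_p.
rewrite Rpower_gt0 /=; apply/RltP; rewrite -[X in Rlt _ X]exp_0.
apply: exp_increasing; apply/RltP; rewrite RmultE pmulr_rlt0 ?oppr_gt0 //.
by apply/RltP; rewrite -[X in Rlt _ X]ln_1; apply: ln_increasing.
Qed.

(** The product is padded with ones so that its index range depends on [n] only, the same for every
    order [m] dividing [n]. *)
Lemma Rpower_div_totient (r : R) (m n : nat) : (0 < n)%N -> (m %| n)%N ->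
  Rpower (Rdiv (INR m) (INR (totient m))) r =
  \prod_(i < n.+1) (if prime i && (i %| m)%N then local_weight r i else 1).
Proof.
move=> n_gt0 dv_m_n; have m_gt0 := dvdn_gt0 n_gt0 dv_m_n.
rewrite RdivE !INRE div_totient // Rpower_prod; last first.
  move=> p; rewrite mem_primes => /andP[/prime_ratio_bounds/andP[? _] _].
  by rewrite invr_gt0.
rewrite -big_mkcond -(big_mkord (fun i => prime i && (i %| m)%N) (local_weight r)).
rewrite -[RHS]big_filter; set s := filter _ _.
have -> : \prod_(i <- s) local_weight r i = \prod_(i <- primes m) local_weight r i.
  apply/perm_big/uniq_perm; rewrite ?filter_uniq ?iota_uniq ?primes_uniq // => p.
  rewrite mem_filter mem_index_iota mem_primes m_gt0 /= ltnS.
  apply: andb_idr => /andP[_ dv_p_m].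
  by rewrite (leq_trans (dvdn_leq m_gt0 dv_p_m)) // dvdn_leq.
apply: eq_big_seq => p; rewrite mem_primes => /andP[pr_p _].
have /andP[x_gt0 _] := prime_ratio_bounds pr_p.
by rewrite /local_weight pr_p Rpower_inv.
Qed.

(* inord p is 0 for p > n, so only the membership of p <= n is meaningful. *)
Definition nat_pred_of (n : nat) (S : {set 'I_n.+1}) : nat_pred :=
  [pred p | inord p \in S].

(** For [r < 0] this is the probability of drawing [S] when each [i] is put in independently with
    probability [local_weight r i]. *)
Definition set_weight (r : R) (n : nat) (S : {set 'I_n.+1}) : R :=
  \prod_(i < n.+1) (if i \in S then local_weight r i else 1 - local_weight r i).

Lemma set_weight_gt0 (r : R) (n : nat) (S : {set 'I_n.+1}) :
  r < 0 -> 0 < set_weight r S.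
Proof.
move=> r_lt0; apply: prodr_gt0 => i _.
by have /andP[] := local_weight_bounds i r_lt0; case: ifP; rewrite ?subr_gt0.
Qed.

Lemma Rpower_div_totient_sum (r : R) (m n : nat) : (0 < n)%N -> (m %| n)%N ->
  Rpower (Rdiv (INR m) (INR (totient m))) r =
  \sum_(S : {set 'I_n.+1} | (m %| n`_(nat_pred_of S))%N) set_weight r S.
Proof.
move=> n_gt0 dv_m_n; have m_gt0 := dvdn_gt0 n_gt0 dv_m_n.
(* [G i] completes [local_weight r i] to the factor at [i]. After distributing, its zeros kill every
   [S] that misses a prime divisor of [m]. *)
pose G (i : 'I_n.+1) : R :=
  if prime i && (i %| m)%N then 0 else 1 - local_weight r i.
rewrite (Rpower_div_totient r n_gt0 dv_m_n).
rewrite (eq_bigr (fun i : 'I_n.+1 => local_weight r i + G i)); last first.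
  by move=> i _; rewrite /G; case: ifP; rewrite ?addr0 // addrC subrK.
rewrite bigA_distr [RHS]big_mkcond /=; apply: eq_big => // S _.
(* As [m] divides [n], it divides the [S]-part of [n] exactly when all its prime divisors are in
   [S]. *)
have -> : (m %| n`_(nat_pred_of S))%N =
    [forall (i : 'I_n.+1 | prime i && (i %| m)%N), i \in S].
  apply/idP/forall_inP => [dv_m i /andP[pr_i dv_i] | sS].
    have := pnat_dvd (dvdn_trans dv_i dv_m) (part_pnat _ _).
    by rewrite pnatE // inE inord_val.
  rewrite -(@part_pnat_id (nat_pred_of S) m) ?partn_dvd //; apply/pnatP=> // p pr_p dv_p.
  have p_lt : (p < n.+1)%N by rewrite ltnS dvdn_leq // (dvdn_trans dv_p).
  by rewrite inE sS // inordK // pr_p.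
case: ifP => [/forall_inP sS | /negbT/forall_inPn[i Pi notSi]]; last first.
  by rewrite (bigD1 i) //= (negPf notSi) /G ifT ?mul0r.
apply: eq_bigr => i _; case: ifP => // /negbT notSi.
by rewrite /G ifN // (contra (sS i)).
Qed.

(** Exchanging the two sums, each [S] is counted once for every [x] whose order divides the [S]-part
    of [n]. *)
Lemma sum_Rpower_div_totient (gT : finGroupType) (G : {group gT}) (n : nat) (r : R) :
    (0 < n)%N ->
  \sum_(x in G | (#[x]%g %| n)%N)
     Rpower (Rdiv (INR #[x]%g) (INR (totient #[x]%g))) r =
  \sum_(S : {set 'I_n.+1}) set_weight r S *+ #|'Ldiv_(n`_(nat_pred_of S))(G)%g|.
Proof.
move=> n_gt0; rewrite (eq_bigr (fun x => \sum_(S : {set 'I_n.+1} |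
  (#[x]%g %| n`_(nat_pred_of S))%N) set_weight r S)); last first.
  by move=> x /andP[_ dv_x]; exact: Rpower_div_totient_sum.
rewrite (exchange_big_dep xpredT) //=; apply: eq_bigr => S _.
rewrite sumr_const; congr (_ *+ _); apply: eq_card => x.
rewrite !inE -order_dvdn unfold_in -andbA; congr (_ && _).
by apply: andb_idl => /dvdn_trans->//; rewrite dvdn_part.
Qed.

End Weights.

(** * Sign and vanishing of [Tdiff] *)

Section Differences.

Import Order.TTheory GRing.Theory Num.Theory.

Lemma card_cyc (N : nat) : 0 < N -> #|cyc N| = N.
Proof. by move=> N_gt0; rewrite cardsT card_ord prednK. Qed.

Lemma cyclic_cyc (N : nat) : cyclic (cyc N).
Proof. by apply/cyclicP; exists Zp1; exact: Zp_cycle. Qed.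

Lemma Rsum_div_totient (gT : finGroupType) (G : {group gT}) (n : nat) (r : R) :
  Rsum G n r r =
  \big[Rplus/R0]_(x in G | #[x]%g %| n)
     Rpower (Rdiv (INR #[x]%g) (INR (totient #[x]%g))) r.
Proof.
by apply: eq_bigr => x _; rewrite Rpower_div // INRE ltr0n ?totient_gt0 order_gt0.
Qed.

Lemma Ssum_Rsum (gT : finGroupType) (G : {group gT}) (r : R) :
  Ssum G r = Rsum G #|G| r r.
Proof.
rewrite Rsum_div_totient; apply: eq_bigl => x.
by apply/esym/andb_idr => /order_dvdG.
Qed.

(** The cyclic group attains the Frobenius bound for every [S]. The same bound for [G] ensures that
    the subtraction in [nat] does not truncate. *)
Lemma Tdiff_sum (gT : finGroupType) (G : {group gT}) (n : nat) (r : R) :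
    0 < n -> n %| #|G| ->
  Tdiff G n r r =
  (\sum_(S : {set 'I_n.+1})
     set_weight r S *+ (#|'Ldiv_(n`_(nat_pred_of S))(G)%g| - n`_(nat_pred_of S)))%R.
Proof.
move=> n_gt0 dv_n_G; pose C : {group 'I_(#|G|.-1).+1} := [group of cyc #|G|].
have oC : #|C| = #|G| by rewrite card_cyc.
have dv_part S : n`_(nat_pred_of (n := n) S) %| #|G|.
  exact: dvdn_trans (dvdn_part _ _) dv_n_G.
rewrite /Tdiff (Rsum_div_totient G) (Rsum_div_totient C).
rewrite (sum_Rpower_div_totient G r n_gt0) (sum_Rpower_div_totient C r n_gt0).
rewrite RminusE -sumrB; apply: eq_bigr => S _.
rewrite (card_Ldiv_cyclic (cyclic_cyc _)) ?oC // mulrnBr //.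
exact: leq_card_Ldiv.
Qed.

Lemma Tdiff_ge0_eq0 (gT : finGroupType) (G : {group gT}) (n : nat) (r : R) :
    Rlt r R0 -> 0 < n -> n %| #|G| ->
  Rle R0 (Tdiff G n r r) /\
  (Tdiff G n r r = R0 <->
     forall pi : nat_pred, #|'Ldiv_(n`_pi)(G)%g| = n`_pi).
Proof.
move=> /RltP r_lt0 n_gt0 dv_n_G; rewrite Tdiff_sum //.
have w_ge0 (S : {set 'I_n.+1}) (k : nat) : (0 <= set_weight r S *+ k)%R.
  by rewrite mulrn_wge0 // ltW ?set_weight_gt0.
split; first by apply/RleP; rewrite sumr_ge0.
split=> [/psumr_eq0P eq0 pi | oL]; last first.
  by apply: big1 => S _; rewrite oL subnn.
(* Only primes dividing [n] affect the [pi]-part, and these are at most [n], so an arbitrary [pi]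
   may be replaced by its trace on ['I_n.+1]. *)
pose S : {set 'I_n.+1} := [set i : 'I_n.+1 | (i : nat) \in pi].
have -> : n`_pi = n`_(nat_pred_of S).
  apply: eq_in_partn => p; rewrite mem_primes => /and3P[_ _ dv_p].
  by rewrite !inE inordK // ltnS dvdn_leq.
apply/eqP; rewrite eqn_leq andbC leq_card_Ldiv ?(dvdn_trans (dvdn_part _ _)) //=.
have /eqP := eq0 (fun S _ => w_ge0 S _) S isT.
by rewrite mulrn_eq0 (gt_eqF (set_weight_gt0 S r_lt0)) orbF subn_eq0.
Qed.

End Differences.

Theorem mainTheorem5 :
  (forall (gT : finGroupType) (G : {group gT}) (n : nat) (r s : R),
     s = r -> Rlt r R0 -> 0 < n -> n %| #|G| ->
     Rle R0 (Tdiff G n r s) /\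
     (Tdiff G n r s = R0 <->
        exists H : {group gT},
          [/\ H \subset G, #|H| = n, nilpotent H &
              forall K : {group gT}, K \subset G -> #|K| = n -> K :=: H]))
  /\
  (forall (r : R) (gT : finGroupType) (G : {group gT}),
     Rlt r R0 ->
     Rle (Ssum (cyc #|G|) r) (Ssum G r) /\
     (Ssum G r = Ssum (cyc #|G|) r <-> nilpotent G)).
Proof.
have T_ge0_eq0 (gT : finGroupType) (G : {group gT}) (n : nat) (r : R) :
    Rlt r R0 -> 0 < n -> n %| #|G| ->
  Rle R0 (Tdiff G n r r) /\
  (Tdiff G n r r = R0 <->
     exists H : {group gT},
       [/\ H \subset G, #|H| = n, nilpotent H &
           forall K : {group gT}, K \subset G -> #|K| = n -> K :=: H]).
  move=> r_lt0 n_gt0 dv_n_G; have [T_ge0 T_eq0] := Tdiff_ge0_eq0 r_lt0 n_gt0 dv_n_G.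
  by split=> //; exact: iff_trans T_eq0 (unique_nilpotent_subgroupP n_gt0 dv_n_G).
split=> [gT G n r s -> r_lt0 n_gt0 dv_n_G | r gT G r_lt0]; first exact: T_ge0_eq0.
(* For [n = #|G|] the only subgroup of order [n] is [G], so the equality criterion becomes
   nilpotency of [G]. *)
have [T_ge0 T_eq0] := T_ge0_eq0 gT G #|G| r r_lt0 (cardG_gt0 G) (dvdnn _).
have eqT : Tdiff G #|G| r r = Rminus (Ssum G r) (Ssum (cyc #|G|) r).
  by rewrite Ssum_Rsum (Ssum_Rsum [group of cyc #|G|]) /= card_cyc //.
rewrite eqT in T_ge0 T_eq0; split; first by apply/Rge_le/Rminus_ge/Rle_ge.
split=> [eqS | nilG].
  have /T_eq0[H [sHG oH nilH _]] : Rminus (Ssum G r) (Ssum (cyc #|G|) r) = R0.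
    by rewrite eqS; exact: Rminus_diag.
  by have /eqP <- : H :==: G by rewrite eqEcard sHG oH leqnn.
apply: Rminus_diag_uniq; apply/T_eq0; exists G; split=> // K sKG oK.
by apply/eqP; rewrite eqEcard sKG oK leqnn.
Qed.
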